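(* Let $1<c<2$ and let $G=\{p^c : p \text{ prime}\}$, so that the Beurling integers generated by $G$ are $B=\{n^c : n\ge 1\}$. Then this system is maximal lacunary: $\inf_i (b_{i+1}-b_i)>0$, but for every real $\alpha>1$, the Beurling integers $b'_0=1\le b'_1\le\dots$ generated by $G\cup\{\alpha\}$ satisfy $\inf_i (b'_{i+1}-b'_i)=0$.
   Context: For a sequence $G=\{g_1,g_2,\dots\}$ of real numbers with $1<g_1\le g_2\le\dots$ (the generators), the associated Beurling integers are the sequence $B=\{b_0,b_1,b_2,\dots\}$, $b_0=1\le b_1\le b_2\le\dots$, consisting of all finite products of elements of $G$ (repetitions of factors allowed, the empty product being $1$), listed in nondecreasing order with multiplicity. A system is called maximal lacunary if $\inf_i(b_{i+1}-b_i)>0$, but adding any further number to $G$ destroys this property. *)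

(* Defs.v *)
From mathcomp Require Export all_boot all_order all_algebra.
From mathcomp Require Export multiset.
From mathcomp Require Export all_classical all_reals all_analysis.
Set Implicit Arguments.
Unset Strict Implicit.
Unset Printing Implicit Defensive.
Import Order.TTheory GRing.Theory Num.Theory.
Local Open Scope classical_set_scope.
Local Open Scope mset_scope.
Local Open Scope ring_scope.

Lemma ex_prime_gt (n : nat) : exists p, (n < p)%N && prime p.
Proof. by have [p ltnp pr_p] := prime_above n; exists p; rewrite ltnp. Qed.

Definition next_prime (n : nat) : nat := ex_minn (ex_prime_gt n).

(* Numbered from 0: 2, 3, 5, 7, ... *)
Definition nth_prime (i : nat) : nat := iter i next_prime 2.

Definition beurling_generators (R : realType) (g : nat -> R) : Prop :=
  1 < g 0%N /\ nondecreasing_seq g.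

(* Multiplicity is that of the factorizations: a formal product is a finite   *)
(* multiset of indices of generators, and every formal product is listed      *)
(* exactly once, so b is determined by g.                                     *)
Definition beurling_integers (R : realType) (g b : nat -> R) : Prop :=
  nondecreasing_seq b /\
  exists2 m : nat -> {mset nat}, bijective m &
    forall i, b i = \prod_(j <- m i) g j.

(* G with the further number a: sorted insertion of a into the nondecreasing  *)
(* sequence g. If a already occurs in g, then its multiplicity increases.     *)
Definition adjoin (R : realType) (a : R) (g : nat -> R) (i : nat) : R :=
  if g i <= a then g i
  else if (i == 0)%N || (g i.-1 <= a) then a
  else g i.-1.

Definition inf_gap (R : realType) (b : nat -> R) : R :=
  inf (range (fun i => b i.+1 - b i)).

Definition lacunary (R : realType) (g : nat -> R) : Prop :=
  exists2 b, beurling_integers g b & 0 < inf_gap b.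

Definition maximal_lacunary (R : realType) (g : nat -> R) : Prop :=
  lacunary g /\ forall a, 1 < a -> ~ lacunary (adjoin a g).

Definition prime_powers (R : realType) (c : R) (i : nat) : R :=
  (nth_prime i)%:R `^ c.

(* Main.v *)
Require Import Defs.
From mathcomp Require Import finmap ring lra.
Set Implicit Arguments.
Unset Strict Implicit.
Unset Printing Implicit Defensive.
Import Order.TTheory GRing.Theory Num.Theory.
Local Open Scope classical_set_scope.
Local Open Scope mset_scope.
Local Open Scope ring_scope.

(* The gaps of n^c are at least 1 since (x + 1)^c >= x^c + 1. Adjoining a     *)
(* brings in the numbers a n^c = (n a^(1/c))^c, and Dirichlet's theorem gives *)
(* n <= N with n a^(1/c) within 1/N of an integer m. As the c-th power has    *)
(* slope O(N^(c - 1)) on [0, O(N)], a n^c and m^c differ by O(N^(c - 2)),     *)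
(* which tends to 0. They are distinct formal products even if they are       *)
(* equal, because only the first one involves a.                              *)

(** Unique factorization turns the formal products of the p^c into the numbers n^c
    ([beurling_integers_prime_powers]), whose gaps are bounded below because c >= 1
    ([powR_gap_ge1]). Once a is adjoined, [close_powR] finds a n^c and m^c as close as desired: an
    error below 1/N before taking c-th powers is magnified by a factor of order N^(c - 1), and c < 2
    makes the product small. Two close terms of a sorted sequence force a small gap between
    neighbours ([inf_gap_eq0]). That a sorted listing exists after adjoining a is a separate point,
    without which the failure of lacunarity could be vacuous. [beurling_integers_exist] supplies it,
    since only finitely many formal products lie below any bound. *)

Lemma seq_argmin d (R : orderType d) (T : eqType) (f : T -> R) (s : seq T) :
  s != [::] -> exists2 x, x \in s & forall y, y \in s -> (f x <= f y)%O.
Proof.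
elim: s => // x [|y s] IHs _.
  by exists x => [|z]; rewrite inE // => /eqP->.
have [//|z zs zmin] := IHs.
have [xz|zx] := leP (f x) (f z).
  exists x; first exact: mem_head.
  by move=> t; rewrite inE => /predU1P[->//|/zmin]; exact: le_trans.
exists z; first by rewrite inE zs orbT.
by move=> t; rewrite inE => /predU1P[->|/zmin//]; exact: ltW.
Qed.

Lemma injective_fresh (T : eqType) (h : nat -> T) (s : seq T) :
  injective h -> exists n, h n \notin s.
Proof.
move=> h_inj; apply: contrapT => /forallNP sT.
have : (size (map h (iota 0 (size s).+1)) <= size s)%N.
  apply: uniq_leq_size; first by rewrite map_inj_uniq // iota_uniq.
  by move=> _ /mapP[n _ ->]; apply: contrapT => /negP; exact: sT.
by rewrite size_map size_iota ltnn.
Qed.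

(* Enumerate greedily: always take a minimizer of f among the elements not    *)
(* yet listed.                                                                *)
Lemma sorted_enumeration d (R : orderType d) (T : choiceType)
    (f : T -> R) (h : nat -> T) :
  injective h ->
  (forall X, exists s : seq T, forall x, (f x <= X)%O -> x \in s) ->
  exists2 m : nat -> T, bijective m & nondecreasing_seq (f \o m).
Proof.
move=> h_inj fin.
have pick (s : seq T) :
    exists x, x \notin s /\ forall y, y \notin s -> (f x <= f y)%O.
  have [n] := @injective_fresh _ h s h_inj; move: (h n) => x0 x0s.
  have [t tP] := fin (f x0).
  have x0t : x0 \in [seq y <- t | y \notin s] by rewrite mem_filter x0s tP.
  have [|x] := @seq_argmin _ _ _ f [seq y <- t | y \notin s].
    by apply: contraTneq x0t => ->.
  rewrite mem_filter => /andP[xs _] xmin; exists x; split=> // y ys.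
  have [yx0|/ltW x0y] := leP (f y) (f x0); last exact/(le_trans _ x0y)/xmin.
  by apply: xmin; rewrite mem_filter ys tP.
have [nxt nxtP] := choice pick.
pose sel n := iter n (fun s => nxt s :: s) [::].
pose m n := nxt (sel n).
have selS n : sel n.+1 = m n :: sel n by [].
have m_sel k n : (k < n)%N -> m k \in sel n.
  elim: n => // n IHn; rewrite ltnS selS inE leq_eqVlt => /predU1P[->|/IHn->].
    by rewrite eqxx.
  exact: orbT.
have m_inj : injective m.
  move=> i j mij; case: (ltngtP i j) => // /m_sel.
    by rewrite mij (negPf (nxtP _).1).
  by rewrite -mij (negPf (nxtP _).1).
have m_surj x : exists n, m n = x.
  apply: contrapT => /forallNP xm.
  have xsel n : x \notin sel n.
    elim: n => // n IHn; rewrite selS inE negb_or IHn andbT.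
    by apply/eqP => /esym; exact: xm.
  have [t tP] := fin (f x).
  have [n /negP[]] := @injective_fresh _ m t m_inj; apply: tP.
  exact: (nxtP (sel n)).2.
have [g gK] := choice m_surj.
exists m; first by exists g => // n; apply: m_inj; rewrite gK.
apply/nondecreasing_seqP => n; apply: (nxtP (sel n)).2.
by have := (nxtP (sel n.+1)).1; rewrite selS inE negb_or => /andP[].
Qed.

Lemma prod_seq_mset (R : comPzSemiRingType) (T : choiceType) (F : T -> R)
    (s : seq T) :
  \prod_(j <- seq_mset s) F j = \prod_(j <- s) F j.
Proof. by apply: perm_big; exact: perm_eq_seq_mset. Qed.

Lemma expr_size_le_prod (R : numDomainType) (T : Type) (F : T -> R) (x : R)
    (s : seq T) :
  0 <= x -> (forall j, x <= F j) -> x ^+ size s <= \prod_(j <- s) F j.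
Proof.
move=> x0 xF; elim: s => [|j s IHs]; first by rewrite big_nil.
by rewrite big_cons exprS ler_pM ?exprn_ge0.
Qed.

(** All generators are at least [g 0 > 1], so the bound [X] limits the number of factors; as [g] is
    unbounded, it also limits the indices that can occur. *)
Lemma bounded_prod_finite (R : realType) (g : nat -> R) (X : R) :
  beurling_generators g -> (forall Y, exists n, Y < g n) ->
  exists L : seq {mset nat},
    forall A : {mset nat}, \prod_(j <- A) g j <= X -> A \in L.
Proof.
move=> [g0 g_nd] g_unb.
have g1 j : 1 < g j by apply: lt_le_trans g0 (g_nd _ _ _).
have [J XJ] := g_unb X.
have [K XK] : exists K, X < g 0%N ^+ K.
  have d0 : 0 < g 0%N - 1 by rewrite subr_gt0.
  (* By Bernoulli's inequality, any [K] above [X / (g 0 - 1)] will do. *)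
  exists (Num.truncn (X / (g 0%N - 1))).+1.
  set k := _.+1.
  have kX : X < (g 0%N - 1) * k%:R by rewrite mulrC -ltr_pdivrMr // truncnS_gt.
  have bern i : 1 + (g 0%N - 1) * i%:R <= g 0%N ^+ i.
    elim: i => [|i IHi]; first by rewrite mulr0 addr0.
    rewrite exprS; apply: le_trans (_ : g 0%N * (1 + (g 0%N - 1) * i%:R) <= _).
      (* The two sides differ by (x - 1)^2 i, where x is [g 0]. *)
      rewrite -natr1; have : 0 <= i%:R :> R by [].
      move: (g 0%N) (i%:R) => x y /(mulr_ge0 (sqr_ge0 (x - 1))); lra.
    by rewrite ler_pM2l // (lt_trans ltr01).
  by apply: lt_le_trans kX (le_trans _ (bern k)); rewrite lerDr.
(* [L k] contains every multiset of at most [k] indices below [J]; putting [mset0] back at each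
   stage keeps the smaller ones. *)
pose L k := iter k (fun l => mset0 :: [seq j +` A | j <- iota 0 J, A <- l])
  [:: mset0].
have L0 k : mset0 \in L k by case: k => [|k]; exact: mem_head.
have LP k (s : seq nat) :
    (size s <= k)%N -> all (fun j => j < J)%N s -> seq_mset s \in L k.
  have nil0 : seq_mset [::] = mset0 :> {mset nat}.
    by apply/msetP => i; rewrite mset_seqE mset0E.
  elim: k s => [|k IHk] [|j s]; [by rewrite nil0 | by [] | by rewrite nil0 |].
  rewrite ltnS => sk /andP[jJ sJ]; rewrite inE mset_cons; apply/orP; right.
  by apply: allpairs_f; [rewrite mem_iota | exact: IHk].
exists (L K) => A.
rewrite -(seq_mset_id A) prod_seq_mset => AX.
have prod_ge1 (s : seq nat) : 1 <= \prod_(j <- s) g j.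
  by have := expr_size_le_prod s ler01 (fun j => ltW (g1 j)); rewrite expr1n.
apply: LP.
  rewrite leqNgt; apply/negP => KA; have : g 0%N ^+ K <= X.
    apply: le_trans AX; apply: le_trans (_ : g 0%N ^+ size A <= _).
      by apply: ler_weXn2l; [exact: ltW | exact: ltnW].
    by apply: expr_size_le_prod => [|j]; [exact/ltW/(lt_trans ltr01) | exact: g_nd].
  by rewrite leNgt XK.
apply/allP => j jA; rewrite ltnNge; apply/negP => Jj.
have : g j <= X.
  apply: le_trans AX; rewrite (big_rem j) //= ler_peMr ?prod_ge1 //.
  exact/ltW/(lt_trans ltr01).
by rewrite leNgt (lt_le_trans XJ) // g_nd.
Qed.

(** The singletons [h n] witness that there are infinitely many formal products to enumerate. *)
Lemma beurling_integers_exist (R : realType) (g : nat -> R) :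
  beurling_generators g -> (forall Y, exists n, Y < g n) ->
  exists b, beurling_integers g b.
Proof.
move=> gP g_unb; pose h n : {mset nat} := [mset n].
have h_inj : injective h by apply: msetn_inj.
have [m m_bij m_nd] := sorted_enumeration h_inj
  (fun X => bounded_prod_finite X gP g_unb).
by exists (fun i => \prod_(j <- (m i : {mset nat})) g j); split=> //; exists m.
Qed.

(** In a sorted sequence, the distance from [b i] to any later term is at least the gap that follows
    [b i]. *)
Lemma inf_gap_eq0 (R : realType) (b : nat -> R) :
  nondecreasing_seq b ->
  (forall e, 0 < e -> exists i j, i != j /\ `|b i - b j| < e) ->
  inf_gap b = 0.
Proof.
move=> b_nd close.
have lb0 : lbound (range (fun i => b i.+1 - b i)) 0.
  by move=> _ [i _ <-]; rewrite subr_ge0 b_nd.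
apply/le_anti/andP; split; last by apply: lb_le_inf => //; exists (b 1%N - b 0%N), 0%N.
rewrite leNgt; apply/negP => /close[i [j [ij]]].
wlog {ij} ij : i j / (i < j)%N.
  move=> wl; move: ij; case: ltngtP => // ij _; last rewrite distrC; exact: wl.
rewrite distrC ger0_norm ?subr_ge0 ?b_nd 1?ltnW// ltNge => /negP; apply.
apply: le_trans (_ : b i.+1 - b i <= _); last by rewrite lerB // b_nd.
by apply: ge_inf; [exists 0 | exists i].
Qed.

(** * Enumeration of the primes and unique factorization *)

Lemma nth_primeS i : nth_prime i.+1 = next_prime (nth_prime i).
Proof. by []. Qed.

Lemma prime_nth_prime i : prime (nth_prime i).
Proof.
case: i => // i; rewrite nth_primeS /next_prime.
by case: ex_minnP => p /andP[].
Qed.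

Lemma nth_prime_gt0 i : (0 < nth_prime i)%N.
Proof. exact/prime_gt0/prime_nth_prime. Qed.

Lemma nth_prime_ltS i : (nth_prime i < nth_prime i.+1)%N.
Proof.
by rewrite nth_primeS /next_prime; case: ex_minnP => p /andP[].
Qed.

Lemma nth_prime_lt : {homo nth_prime : i j / (i < j)%N}.
Proof. exact: homo_ltn ltn_trans nth_prime_ltS. Qed.

Lemma nth_prime_le : {homo nth_prime : i j / (i <= j)%N}.
Proof. exact: ltnW_homo nth_prime_lt. Qed.

Lemma nth_prime_inj : injective nth_prime.
Proof.
by move=> i j ij; case: (ltngtP i j) => // /nth_prime_lt; rewrite ij ltnn.
Qed.

Lemma ltn_nth_prime i : (i < nth_prime i)%N.
Proof. by elim: i => // i IHi; exact: leq_ltn_trans IHi (nth_prime_ltS i). Qed.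

Lemma nth_prime_surj p : prime p -> exists i, nth_prime i = p.
Proof.
(* Induction on an index whose prime exceeds [p], starting from [p] itself; no prime lies strictly
   between consecutive values of [nth_prime]. *)
move=> pp; have := ltn_nth_prime p; elim: {2}p => [|i IHi].
  by move=> p2; have := prime_gt1 pp; rewrite ltnNge -ltnS p2.
have [/IHi//|pi] := ltnP p (nth_prime i).
move: pi; rewrite leq_eqVlt => /predU1P[<-|ip]; first by exists i.
rewrite nth_primeS /next_prime; case: ex_minnP => q _ qmin pq.
by have := qmin p; rewrite ip pp => /(_ isT); rewrite leqNgt pq.
Qed.

Lemma prod_nth_prime_gt0 (s : seq nat) : (0 < \prod_(j <- s) nth_prime j)%N.
Proof. by apply: prodn_gt0 => j; exact: nth_prime_gt0. Qed.

(** Uniqueness of factorization: the valuations of the product give back the multiset of indices. *)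
Lemma logn_prod_nth_prime i (s : seq nat) :
  logn (nth_prime i) (\prod_(j <- s) nth_prime j) = count_mem i s.
Proof.
elim: s => [|j s IHs]; first by rewrite big_nil logn1.
rewrite big_cons lognM ?nth_prime_gt0 ?prod_nth_prime_gt0 // IHs /=.
rewrite logn_prime ?prime_nth_prime // (inj_eq nth_prime_inj).
by rewrite eq_sym.
Qed.

Lemma prod_nth_prime_surj n : (0 < n)%N ->
  exists s : seq nat, (\prod_(j <- s) nth_prime j)%N = n.
Proof.
have [N] := ubnP n; elim: N n => // N IHN n nN n0.
have [n1|n_le1] := ltnP 1 n; last first.
  by exists [::]; rewrite big_nil; apply/eqP; rewrite eqn_leq n0.
have [i iP] := nth_prime_surj (pdiv_prime n1).
have [||s sP] := IHN (n %/ pdiv n)%N.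
- apply: leq_trans (ltn_Pdiv (prime_gt1 (pdiv_prime n1)) n0) _.
  by rewrite -ltnS.
- by rewrite divn_gt0 ?pdiv_gt0 // pdiv_leq.
by exists (i :: s); rewrite big_cons iP sP mulnC divnK // pdiv_dvd.
Qed.

(** * The system generated by the p^c *)

Lemma prod_prime_powers (R : realType) (c : R) (s : seq nat) :
  \prod_(j <- s) prime_powers c j = (\prod_(j <- s) nth_prime j)%N%:R `^ c.
Proof.
elim: s => [|j s IHs]; first by rewrite !big_nil powR1.
by rewrite !big_cons IHs natrM powRM.
Qed.

Lemma nondecreasing_prime_powers (R : realType) (c : R) :
  0 <= c -> nondecreasing_seq (prime_powers c).
Proof.
move=> c0 i j ij; apply: ge0_ler_powR; rewrite ?nnegrE //.
by rewrite ler_nat nth_prime_le.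
Qed.

Lemma beurling_generators_prime_powers (R : realType) (c : R) :
  0 < c -> beurling_generators (prime_powers c).
Proof.
move=> c0; split; last exact/nondecreasing_prime_powers/ltW.
by rewrite -[X in X < _](congr1 (@^~ c) (powR1 R)) gt0_ltr_powR // ?nnegrE // ltr1n.
Qed.

Lemma prime_powers_unbounded (R : realType) (c : R) :
  1 <= c -> forall Y : R, exists n, Y < prime_powers c n.
Proof.
move=> c1 Y; exists (Num.truncn Y).+1; apply: lt_le_trans (truncnS_gt Y) _.
apply: le_trans (_ : (nth_prime (Num.truncn Y).+1)%:R <= _).
  by rewrite ler_nat ltnW // ltn_nth_prime.
by apply: le1r_powR => //; rewrite ler1n nth_prime_gt0.
Qed.

(** Existence of factorizations gives the map from integers to multisets, and uniqueness makes it
    bijective. Index n stands for the integer n + 1, hence the predecessor in the inverse. *)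
Lemma beurling_integers_prime_powers (R : realType) (c : R) : 0 <= c ->
  beurling_integers (prime_powers c) (fun n => n.+1%:R `^ c).
Proof.
move=> c0; split.
  by move=> i j ij; apply: ge0_ler_powR; rewrite ?nnegrE ?ler_nat.
have mP n : exists A : {mset nat}, (\prod_(j <- A) nth_prime j)%N = n.+1.
  have [s sP] := prod_nth_prime_surj (ltn0Sn n).
  by exists (seq_mset s); rewrite (perm_big _ (perm_eq_seq_mset s)).
have [m {}mP] := choice mP.
exists m; last by move=> i; rewrite prod_prime_powers mP.
exists (fun A : {mset nat} => (\prod_(j <- A) nth_prime j)%N.-1) => [n|A].
  by rewrite mP.
apply/msetP => j.
rewrite -!count_mem_mset -!logn_prod_nth_prime mP prednK //.
exact: prod_nth_prime_gt0.
Qed.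

(** Write (x + 1)^c = x (x + 1)^(c - 1) + (x + 1)^(c - 1): the first term is at least x^c and the
    second at least 1. *)
Lemma powR_gap_ge1 (R : realType) (c x : R) :
  1 <= c -> 0 < x -> 1 <= (x + 1) `^ c - x `^ c.
Proof.
move=> c1 x0.
have xc y : 0 < y -> y `^ c = y * y `^ (c - 1).
  by move=> y0; rewrite mulr_powRB1 ?ltW // (lt_le_trans ltr01).
have x1 : 0 < x + 1 by rewrite addr_gt0.
rewrite !xc //.
have le1 : 1 <= (x + 1) `^ (c - 1).
  rewrite -[X in X <= _](congr1 (@^~ (c - 1)) (powR1 R)).
  by rewrite ge0_ler_powR ?subr_ge0 ?nnegrE ?lerDr ?(ltW x0) ?(ltW x1).
have lex : x `^ (c - 1) <= (x + 1) `^ (c - 1).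
  by rewrite ge0_ler_powR ?subr_ge0 ?nnegrE ?lerDl ?(ltW x0) ?(ltW x1).
have := ler_wpM2l (ltW x0) lex; lra.
Qed.

Lemma inf_gap_powR_gt0 (R : realType) (c : R) : 1 <= c ->
  0 < inf_gap (fun n : nat => n.+1%:R `^ c : R).
Proof.
move=> c1; apply: lt_le_trans ltr01 _; apply: lb_le_inf.
  by exists (2%:R `^ c - 1%:R `^ c), 0%N.
by move=> _ [n _ <-]; rewrite -[n.+2%:R]natr1 powR_gap_ge1.
Qed.

(** * Approximation of a n^c by c-th powers of integers *)

(** Pigeonhole: two of the N + 1 fractional parts of i x, for i from 0 to N, fall into the same of N
    boxes of length 1/N. *)
Lemma dirichlet_approximation (R : realType) (x : R) (N : nat) :
  0 <= x -> (0 < N)%N ->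
  exists n m : nat, [/\ (0 < n <= N)%N & `|n%:R * x - m%:R| < N%:R^-1].
Proof.
move=> x0 N0; have NR0 : 0 < N%:R :> R by rewrite ltr0n.
pose t (i : nat) := Num.truncn (i%:R * x).
have tP i : (t i)%:R <= i%:R * x < (t i)%:R + 1.
  by rewrite natr1; apply: truncn_itv; rewrite mulr_ge0.
pose y (i : nat) := N%:R * (i%:R * x - (t i)%:R).
have y0 i : 0 <= y i by rewrite mulr_ge0 // subr_ge0; case/andP: (tP i).
have f_lt (i : 'I_N.+1) : (Num.truncn (y i) < N)%N.
  rewrite truncn_lt_nat // -[X in _ < X]mulr1 ltr_pM2l // ltrBlDl.
  by case/andP: (tP i).
pose f i := Ordinal (f_lt i).
have /injectivePn[i [j ij fij]] : ~~ injectiveb f.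
  by apply/negP => /injectiveP/leq_card; rewrite !card_ord ltnn.
have {fij} : Num.truncn (y i) = Num.truncn (y j) := congr1 val fij.
have {ij} : (i : nat) != j by [].
have : (i <= N)%N by rewrite -ltnS.
have : (j <= N)%N by rewrite -ltnS.
move: (i : nat) (j : nat) => {f_lt f} {}i {}j.
wlog ij : i j / (i < j)%N.
  move=> wl jN iN; case: (ltngtP i j) => // ij _ fij.
    by apply: (wl i j); rewrite ?ltn_eqF.
  by apply: (wl j i); rewrite ?ltn_eqF.
move=> jN _ _ fij; exists (j - i)%N, (t j - t i)%N; split.
  by rewrite subn_gt0 ij (leq_trans (leq_subr _ _)).
(* Needed for the truncated subtraction [t j - t i] to be the true difference. *)
have tij : (t i <= t j)%N.
  by apply: le_truncn; rewrite ler_wpM2r // ler_nat ltnW.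
rewrite !natrB ?(ltnW ij) //.
have /andP[] := truncn_itv (y0 i); have /andP[] := truncn_itv (y0 j).
rewrite fij -natr1 /y => a1 a2 a3 a4.
rewrite -[X in _ < X]mul1r ltr_pdivlMr // mulrC -{1}(gtr0_norm NR0) -normrM ltr_norml.
by apply/andP; split; lra.
Qed.

(** A mean value bound without derivatives: for q = y/x in (0, 1], c <= 2 gives q^c >= q^2, so 1 -
    q^c <= 1 - q^2 <= 2 (1 - q); multiply by x^c. *)
Lemma powR_sub_le (R : realType) (c x y : R) :
  1 <= c <= 2 -> 0 < y <= x -> x `^ c - y `^ c <= 2 * x `^ (c - 1) * (x - y).
Proof.
move=> /andP[c1 c2] /andP[y0 yx]; have x0 := lt_le_trans y0 yx.
pose q := y / x; have q01 : 0 < q <= 1.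
  by rewrite divr_gt0 //= ler_pdivrMr // mul1r.
have yE : y = q * x by rewrite divfK // gt_eqF.
have qc : q ^+ 2 <= q `^ c.
  by rewrite -powR_mulrn ?ger_powR //; case/andP: q01 => /ltW.
case/andP: q01 => q0 q1.
rewrite yE powRM ?(ltW q0) ?(ltW x0) // -(mulr_powRB1 (ltW x0)) ?(lt_le_trans ltr01) //.
have xq : 0 <= x * x `^ (c - 1) by rewrite mulr_ge0 ?powR_ge0 ?ltW.
have := ler_wpM2r xq qc; have := mulr_ge0 xq (sqr_ge0 (q - 1)).
by move: (x `^ (c - 1)) (q `^ c) => u v; lra.
Qed.

Lemma dist_powR_le (R : realType) (c x y M : R) :
  1 <= c <= 2 -> 0 < x <= M -> 0 < y <= M ->
  `|x `^ c - y `^ c| <= 2 * M `^ (c - 1) * `|x - y|.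
Proof.
move=> c12; wlog yx : x y / y <= x.
  move=> wl xM yM; have [yx|/ltW xy] := leP y x; first exact: wl.
  by rewrite (distrC (x `^ c)) (distrC x); exact: wl.
move=> /andP[x0 xM] /andP[y0 _]; case/andP: (c12) => c1 _.
have c0 : 0 <= c by apply: le_trans c1.
rewrite !ger0_norm ?subr_ge0 //; last first.
  by rewrite ge0_ler_powR ?nnegrE ?(ltW x0) ?(ltW y0).
apply: le_trans (powR_sub_le c12 _) _; first by rewrite y0.
rewrite ler_wpM2r ?subr_ge0 // ler_wpM2l //.
by rewrite ge0_ler_powR ?subr_ge0 ?nnegrE ?(ltW x0) ?(le_trans (ltW x0)).
Qed.

Lemma close_powR (R : realType) (a c e : R) :
  1 < a -> 1 < c < 2 -> 0 < e ->
  exists n m : nat, [/\ (0 < n)%N, (0 < m)%N & `|a * n%:R `^ c - m%:R `^ c| < e].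
Proof.
move=> a1 /andP[c1 c2] e0; have c0 : 0 < c by rewrite (lt_trans ltr01).
pose x := a `^ c^-1.
have x1 : 1 <= x.
  rewrite -[X in X <= _](congr1 (@^~ c^-1) (powR1 R)).
  have a0 := le_trans ler01 (ltW a1).
  by rewrite ge0_ler_powR ?invr_ge0 ?nnegrE ?a0 ?(ltW a1) ?(ltW c0).
have x0 : 0 < x := lt_le_trans ltr01 x1.
have xc : x `^ c = a.
  by rewrite -powRrM mulVf ?gt_eqF // powRr1 // (le_trans ler01 (ltW a1)).
(* The final bound 2 (N (x + 1))^(c - 1) / N equals K e / N^(2 - c), so [N] is chosen with N^(2 - c)
   > K. *)
pose K := 2 * (x + 1) `^ (c - 1) / e.
have c2' : 0 < 2 - c by rewrite subr_gt0.
have K0 : 0 <= K by rewrite divr_ge0 ?mulr_ge0 ?powR_ge0 ?(ltW e0).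
pose N := (Num.truncn (K `^ (2 - c)^-1)).+1.
have N0 : 0 < N%:R :> R by rewrite ltr0n.
have KN : K < N%:R `^ (2 - c).
  have -> : K = (K `^ (2 - c)^-1) `^ (2 - c).
    by rewrite -powRrM mulVf ?gt_eqF // powRr1.
  by rewrite gt0_ltr_powR ?nnegrE ?powR_ge0 ?(ltW N0) // truncnS_gt.
have [n [m [/andP[n0 nN] nxm]]] := dirichlet_approximation (ltW x0) (ltn0Sn _ : 0 < N)%N.
have n1 : 1 <= n%:R :> R by rewrite ler1n.
have nNR : n%:R <= N%:R :> R by rewrite ler_nat.
have N1 : 1 <= N%:R :> R by rewrite ler1n.
have VN1 : N%:R^-1 <= 1 :> R by rewrite invf_le1.
have nx1 : 1 <= n%:R * x by rewrite mulr_ege1.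
have nxN : n%:R * x <= N%:R * x by rewrite ler_wpM2r ?(ltW x0).
(* Since n x >= 1, this makes m positive; it also gives m < n x + 1 <= N (x + 1), so that
   [dist_powR_le] applies with M = N (x + 1). *)
have /andP[nxm1 nxm2] : - 1 < n%:R * x - m%:R < 1.
  by rewrite -ltr_norml (lt_le_trans nxm).
have m0 : 0 < m%:R :> R by lra.
exists n, m; split=> //; first by rewrite -(ltr0n R).
have -> : a * n%:R `^ c = (n%:R * x) `^ c.
  by rewrite powRM ?(ltW x0) // xc mulrC.
have c12 : 1 <= c <= 2 by rewrite !ltW.
apply: le_lt_trans (dist_powR_le (M := N%:R * (x + 1)) c12 _ _) _.
- by apply/andP; split; lra.
- by apply/andP; split; lra.
apply: le_lt_trans (_ : 2 * (N%:R * (x + 1)) `^ (c - 1) * N%:R^-1 < e).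
  by rewrite ler_wpM2l ?mulr_ge0 ?powR_ge0 // ltW.
rewrite powRM ?ler0n ?addr_ge0 ?(ltW x0) //.
have -> : N%:R `^ (c - 1) = N%:R / N%:R `^ (2 - c).
  rewrite (_ : c - 1 = 1 - (2 - c)); last by ring.
  by rewrite powRB ?(powRr1 (ltW N0)) // (gt_eqF N0) implybT.
rewrite (_ : _ * _ * _ = K * e / N%:R `^ (2 - c)).
  by rewrite ltr_pdivrMr ?powR_gt0 // mulrC ltr_pM2l.
by rewrite /K; field; rewrite !gt_eqF ?powR_gt0.
Qed.

(** * Adjoining a generator *)

(** The insertion point [k] is the first index with [g k > a]; [bump k] skips [k] and so renames the
    old indices. *)
Lemma adjoin_bump (R : realType) (a : R) (g : nat -> R) :
  nondecreasing_seq g -> (forall Y, exists n, Y < g n) ->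
  exists k, adjoin a g k = a /\ forall i, adjoin a g (bump k i) = g i.
Proof.
move=> g_nd g_unb; have [k ak kmin] := ex_minnP (g_unb a).
have g_le i : (i < k)%N -> g i <= a.
  by rewrite ltnNge leNgt; apply: contra => /kmin.
have g_gt i : (k <= i)%N -> (g i <= a) = false.
  by move=> ki; rewrite leNgt (lt_le_trans ak) ?g_nd.
exists k; split=> [|i]; rewrite /adjoin.
  by rewrite g_gt //; case: k g_le {ak kmin g_gt} => //= k -> //.
rewrite /bump; case: leqP => ki; last by rewrite add0n g_le.
by rewrite add1n /= !g_gt // ltnW.
Qed.

Lemma adjoin_generators (R : realType) (a : R) (g : nat -> R) :
  1 < a -> beurling_generators g -> beurling_generators (adjoin a g).
Proof.
move=> a1 [g0 g_nd]; split; first by rewrite /adjoin /=; case: ifP.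
apply/nondecreasing_seqP => n; rewrite /adjoin /=.
have gS : g n <= g n.+1 by exact: g_nd.
have [gn|gn] := leP (g n) a; first by case: ifP.
rewrite [g n.+1 <= a]leNgt (lt_le_trans gn gS) /=.
by case: ifP => _; [exact: ltW | exact/g_nd/leq_pred].
Qed.

Lemma adjoin_unbounded (R : realType) (a : R) (g : nat -> R) :
  nondecreasing_seq g -> (forall Y, exists n, Y < g n) ->
  forall Y, exists n, Y < adjoin a g n.
Proof.
move=> g_nd g_unb Y; have [k [_ gE]] := adjoin_bump a g_nd g_unb.
by have [n Yn] := g_unb Y; exists (bump k n); rewrite gE.
Qed.

Lemma inf_gap_adjoin_prime_powers (R : realType) (a c : R) (b : nat -> R) :
  1 < a -> 1 < c < 2 ->
  beurling_integers (adjoin a (prime_powers c)) b -> inf_gap b = 0.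
Proof.
move=> a1 c12 [b_nd [m [m' mK m'K] bE]]; case/andP: (c12) => c1 _.
apply: inf_gap_eq0 => // e e0.
have [n [l [n0 l0 nl]]] := close_powR a1 c12 e0.
have c0 : 0 <= c by rewrite ltW // (lt_trans ltr01).
have [k [kE gE]] := adjoin_bump a (nondecreasing_prime_powers c0)
  (prime_powers_unbounded (ltW c1)).
have [s sn] := prod_nth_prime_surj n0; have [t tl] := prod_nth_prime_surj l0.
have bumpE (r : seq nat) :
    \prod_(j <- map (bump k) r) adjoin a (prime_powers c) j =
    (\prod_(j <- r) nth_prime j)%N%:R `^ c.
  by rewrite big_map (eq_bigr _ (fun i _ => gE i)) prod_prime_powers.
exists (m' (seq_mset (k :: map (bump k) s))), (m' (seq_mset (map (bump k) t))).
split; last by rewrite !bE !m'K !prod_seq_mset big_cons kE !bumpE sn tl.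
(* The multisets differ because [k], the index of [a], is not in the image of [bump k]. *)
rewrite (can_eq m'K); apply/eqP => /eq_seq_msetP/perm_mem/(_ k).
rewrite mem_head => /esym/mapP[i _ ki].
by have := neq_bump k i; rewrite -ki eqxx.
Qed.

Theorem theorem5 (R : realType) (c : R) (hc1 : 1 < c) (hc2 : c < 2) :
  [/\ beurling_generators (prime_powers c),
      beurling_integers (prime_powers c) (fun n : nat => n.+1%:R `^ c),
      0 < inf_gap (fun n : nat => n.+1%:R `^ c),
      forall a : R, 1 < a ->
        exists2 b' : nat -> R,
          beurling_integers (adjoin a (prime_powers c)) b' & inf_gap b' = 0
    & maximal_lacunary (prime_powers c)].
Proof.
have c12 : 1 < c < 2 by rewrite hc1.
have c0 : 0 < c := lt_trans ltr01 hc1.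
have gP := beurling_generators_prime_powers c0.
have bP := beurling_integers_prime_powers (ltW c0).
have gap := inf_gap_powR_gt0 (ltW hc1).
split=> //.
  move=> a a1; have [|b' b'P] := beurling_integers_exist (adjoin_generators a1 gP).
    exact: adjoin_unbounded gP.2 (prime_powers_unbounded (ltW hc1)).
  by exists b' => //; exact: inf_gap_adjoin_prime_powers b'P.
split; first by exists (fun n => n.+1%:R `^ c).
move=> a a1 [b' b'P].
by rewrite (inf_gap_adjoin_prime_powers a1 c12 b'P) ltxx.
Qed.
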